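(* Fix $\beta\in\mathbb{R}$ and let $\vec\sigma$ be a sample from the hardcore model $\mathbb{P}^N_\beta$ on $G_N$. Then $N L^N_{\vec\sigma}(b)$ is the derivative with respect to $b$ of the log pseudo-likelihood function $b\mapsto \log\prod_{u=1}^N \mathbb{P}^N_b(\sigma_u\mid(\sigma_v)_{v\neq u})$. Furthermore, for every $b\in\mathbb{R}$, $$L^N_{\vec\sigma}(b)=\frac1N\Big(c^N(\vec\sigma)-\frac{e^b}{e^b+1}\big[c^N(\vec\sigma)+u^N(\vec\sigma)\big]\Big),$$ and hence the maximum pseudo-likelihood (MPL) estimate of $\beta$ takes the explicit form $$\hat\beta^N(\vec\sigma)=\log\left(\frac{c^N(\vec\sigma)}{u^N(\vec\sigma)}\right);$$ that is, $b\in\mathbb{R}$ is a critical point of the log pseudo-likelihood function if and only if $b=\log(c^N(\vec\sigma)/u^N(\vec\sigma))$, where the right-hand side is read as an extended real number ($-\infty$ if $c^N(\vec\sigma)=0$, $+\infty$ if $u^N(\vec\sigma)=0$).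
   Context: $G_N$ is a finite simple graph with vertex set $[N]=\{1,\dots,N\}$ and edge set $E(G_N)$, with adjacency matrix $(a_{uv}(G_N))$ and no isolated vertices; $\mathcal{N}_{G_N}(u)$ is the set of neighbors of $u$. The hardcore model with parameter $\beta\in\mathbb{R}$ (fugacity $\lambda=e^\beta$) is the probability measure on $\{0,1\}^N$ $$\mathbb{P}^N_\beta(\vec\sigma)=\frac{e^{\beta\sum_{u=1}^N\sigma_u}\prod_{(u,v)\in E(G_N)}(1-\sigma_u\sigma_v)}{Z_{G_N}(e^\beta)},$$ where $Z_{G_N}(e^\beta)$ is the normalizing constant; it is supported on indicator vectors of independent sets of $G_N$. Write $c^N(\vec\sigma)=|\{u:\sigma_u=1\}|$ and $u^N(\vec\sigma)=|\{u\in V(G_N):\sigma_u=0 \text{ and } \sigma_v=0\ \forall v\in\mathcal{N}_{G_N}(u)\}|$. For $b\in\mathbb{R}$, $$L^N_{\vec\sigma}(b)=\frac1N\sum_{u=1}^N\left\{\sigma_u-\frac{e^{b+\sum_{v\ne u}a_{uv}(G_N)\log(1-\sigma_v)}}{e^{b+\sum_{v\ne u}a_{uv}(G_N)\log(1-\sigma_v)}+1}\right\},$$ with conventions $\log 0=-\infty$, $e^{-\infty}=0$, $0\cdot(-\infty)=0$. Here $\mathbb{P}^N_b(\sigma_u\mid(\sigma_v)_{v\ne u})$ is the conditional probability, under $\mathbb{P}^N_b$, of the observed value $\sigma_u$ given the other coordinates. An MPL estimate is any critical point of the log pseudo-likelihood function. *)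

(* Defs.v *)
From HB Require Import structures.
From mathcomp Require Import all_boot all_order all_algebra.
From mathcomp Require Import all_classical all_reals all_analysis.

Set Implicit Arguments.
Unset Strict Implicit.
Unset Printing Implicit Defensive.

Import Order.TTheory GRing.Theory Num.Theory.
Import numFieldNormedType.Exports.

Local Open Scope ring_scope.

Record simple_graph (N : nat) := SimpleGraph {
  adj :> rel 'I_N;
  adj_sym : symmetric adj;
  adj_irr : irreflexive adj }.

(* Each edge {u, v} is represented once, by the ordered pair with u < v. *)
Definition edges (N : nat) (G : simple_graph N) : {set 'I_N * 'I_N} :=
  [set e : 'I_N * 'I_N | (e.1 < e.2)%N & G e.1 e.2].

Definition nbrs (N : nat) (G : simple_graph N) (u : 'I_N) : {set 'I_N} :=
  [set v | G u v].

Definition no_isolated_vertex (N : nat) (G : simple_graph N) : Prop :=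
  forall u : 'I_N, exists v : 'I_N, v \in nbrs G u.

Definition adjmx (R : realType) (N : nat) (G : simple_graph N) : 'M[R]_N :=
  \matrix_(u, v) (G u v)%:R.

(* {0,1}^N, with 1 as true and 0 as false; (s u)%:R is the numerical value. *)
Notation config N := {ffun 'I_N -> bool}.

Section Hardcore.
Context {R : realType} {N : nat} (G : simple_graph N).

Definition hc_weight (b : R) (s : config N) : R :=
  expR (b * \sum_(u < N) (s u)%:R)
  * \prod_(e in edges G) (1 - (s e.1)%:R * (s e.2)%:R).

Definition hc_partition (b : R) : R := \sum_(s : config N) hc_weight b s.

Definition hardcore (b : R) (s : config N) : R :=
  hc_weight b s / hc_partition b.

Definition hc_prob (b : R) (A : {set config N}) : R :=
  \sum_(s in A) hardcore b s.

Definition hc_cond_prob (b : R) (A B : {set config N}) : R :=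
  hc_prob b (A :&: B) / hc_prob b B.

(* The conditional probability P_b(s_u | (s_v)_{v <> u}). *)
Definition hc_cond_coord (b : R) (s : config N) (u : 'I_N) : R :=
  hc_cond_prob b [set t : config N | t u == s u]
                 [set t : config N | [forall (v | v != u), t v == s v]].

Definition log_pseudolik (s : config N) (b : R) : R :=
  ln (\prod_(u < N) hc_cond_coord b s u).

Definition mpl_estimate (s : config N) (b : R) : Prop :=
  is_derive b (1 : R) (log_pseudolik s) (0 : R).

Definition num_occupied (s : config N) : nat := #|[set u | s u]|.

Definition num_unblocked (s : config N) : nat :=
  #|[set u | ~~ s u & [forall v in nbrs G u, ~~ s v]]|.

(* In \bar R one has lne 0 = -oo, expeR -oo = 0 and 0 * -oo = 0. *)
Definition local_exponent (s : config N) (b : R) (u : 'I_N) : \bar R :=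
  (b%:E + \sum_(v < N | v != u)
            (adjmx R G u v)%:E * lne (1 - (s v)%:R)%:E)%E.

(* local_exponent is never +oo, so that fine is applied to a finite value. *)
Definition hc_L (s : config N) (b : R) : R :=
  N%:R^-1 * \sum_(u < N)
    ((s u)%:R - fine (expeR (local_exponent s b u)
                      / (expeR (local_exponent s b u) + 1))%E).

(* In \bar R one has 0^-1 = +oo, lne 0 = -oo and lne +oo = +oo: the value is
   -oo if no vertex is occupied, and +oo if no vertex is unblocked (for N > 0
   the two counts are never both zero). *)
Definition beta_hat (s : config N) : \bar R :=
  lne ((num_occupied s)%:R%:E / (num_unblocked s)%:R%:E)%E.

End Hardcore.

(* Main.v *)
(** Given the other coordinates of an independent configuration, the spin at [u]
  is Bernoulli with mean [e^b / (e^b + 1)] if no neighbour of [u] is occupied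
  and is forced to vanish otherwise.  Vertices of the first kind are the
  occupied and the unblocked ones, so with [c] and [m] their numbers the log
  pseudo-likelihood is [c b - (c + m) ln (e^b + 1)]; its derivative
  [(c - m e^b) / (e^b + 1)] vanishes iff [e^b = c / m].  Since [c + m > 0], the
  degenerate cases [c = 0] and [m = 0] give no real critical point. *)

Require Import Defs.
From mathcomp Require Import all_boot all_order all_algebra.
From mathcomp Require Import all_classical all_reals all_analysis.
From mathcomp Require Import ring.
Import Order.TTheory GRing.Theory Num.Theory.
Import numFieldNormedType.Exports.
Local Open Scope ring_scope.

(** * Independent configurations and changes of a single coordinate *)

Definition independent (N : nat) (G : simple_graph N) (s : config N) : bool :=
  [forall u, forall v, G u v ==> ~~ (s u && s v)].

Definition nbrs_empty (N : nat) (G : simple_graph N) (s : config N) (u : 'I_N) :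
  bool := [forall v in nbrs G u, ~~ s v].

Definition set_coord (N : nat) (s : config N) (u : 'I_N) (x : bool) :
  config N := [ffun v => if v == u then x else s v].

Section Combinatorics.
Context (N : nat) (G : simple_graph N).
Implicit Types (s t : config N) (u v : 'I_N).

Lemma independentP s :
  reflect (forall u v, G u v -> ~~ (s u && s v)) (independent N G s).
Proof.
apply: (iffP forallP) => [H u v|H u].
  by move/forallP: (H u) => /(_ v)/implyP.
by apply/forallP => v; apply/implyP; apply: H.
Qed.

Lemma nbrs_emptyP s u : reflect (forall v, G u v -> ~~ s v) (nbrs_empty N G s u).
Proof.
apply: (iffP forallP) => H v; first by move=> Guv; have := H v; rewrite inE Guv.
by apply/implyP; rewrite inE; exact: H.
Qed.

Lemma independent_nbrs_empty s u : independent N G s -> s u -> nbrs_empty N G s u.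
Proof.
by move=> /independentP si su; apply/nbrs_emptyP => v /si; rewrite su.
Qed.

Lemma set_coord_self s u : set_coord N s u (s u) = s.
Proof. by apply/ffunP => v; rewrite ffunE; case: eqP => [->|]. Qed.

(** Only edges at [u] can be affected. Emptying [u] creates no conflict, and occupying it conflicts
    exactly with occupied neighbours, which differ from [u] and so keep their old values. *)
Lemma set_coord_independent s u x :
  independent N G s -> independent N G (set_coord N s u x) = x ==> nbrs_empty N G s u.
Proof.
move=> /independentP si; apply/independentP/implyP => [H xT|H v w Gvw].
  apply/nbrs_emptyP => v Guv; have := H u v Guv; rewrite !ffunE eqxx xT /=.
  by case: eqP => // vu; move: Guv; rewrite vu adj_irr.
rewrite !ffunE; case: eqP => [vu|_]; case: eqP => [wu|_]; last exact: si.
- by move: Gvw; rewrite vu wu adj_irr.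
- by case: x H => //= /(_ isT)/nbrs_emptyP; apply; rewrite -vu.
- rewrite andbC; case: x H => //= /(_ isT)/nbrs_emptyP; apply.
  by rewrite adj_sym -wu.
Qed.

(** The conditioning event has just two points, so a conditional probability is one weight over a
    sum of two. *)
Lemma agree_off_coord s u :
  [set t : config N | [forall (v | v != u), t v == s v]] =
  [set set_coord N s u true; set_coord N s u false].
Proof.
apply/setP => t; rewrite !inE; apply/forallP/orP => [H|].
  have -> : t = set_coord N s u (t u).
    apply/ffunP => v; rewrite ffunE; case: eqP => [->//|/eqP vu].
    by have := H v; rewrite vu => /eqP.
  by case: (t u); [left|right].
by case=> /eqP -> v; apply/implyP => /negPf vu; rewrite ffunE vu.
Qed.

Lemma agree_on_coord s u :
  [set t : config N | t u == s u] :&: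
  [set t : config N | [forall (v | v != u), t v == s v]] = [set s].
Proof.
apply/setP => t; rewrite !inE; apply/andP/eqP => [[/eqP tu /forallP H]|->].
  apply/ffunP => v; have [->//|vu] := eqVneq v u.
  by have := H v; rewrite vu => /eqP.
by rewrite eqxx; split => //; apply/forallP => v; rewrite eqxx implybT.
Qed.

End Combinatorics.

(** * Weights and conditional probabilities of the hardcore model *)

Section Hardcore.
Context (R : realType) (N : nat) (G : simple_graph N).
Implicit Types (s t : config N) (u v : 'I_N) (b : R).

Lemma hc_weightE b s :
  hc_weight G b s =
  expR (b * \sum_(u < N) (s u)%:R) * (independent N G s)%:R.
Proof.
rewrite /hc_weight; congr (_ * _).
have [si|/independentP nsi] := boolP (independent N G s).
  rewrite big1// => -[u v]; rewrite inE /= => /andP[_ Guv].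
  have /independentP/(_ u v Guv) := si.
  by case: (s u); case: (s v) => //= _; rewrite ?(mulr0, mul0r) subr0.
apply/eqP/prodf_eq0.
have [u [v [Guv su sv]]] : exists u v, [/\ G u v, s u & s v].
  apply: contrapT => H; apply: nsi => u v Guv; apply/negP => /andP[su sv].
  by apply: H; exists u, v.
(* [edges] stores each edge in increasing order only, so the conflicting pair may have to be
   swapped. *)
have [uv|vu|/val_inj uv] := ltngtP u v.
- by exists (u, v); rewrite ?inE /= ?uv // su sv mulr1 subrr.
- by exists (v, u); rewrite ?inE /= ?vu 1?adj_sym // su sv mulr1 subrr.
- by move: Guv; rewrite uv adj_irr.
Qed.

Lemma hc_weight_ge0 b s : 0 <= hc_weight G b s.
Proof. by rewrite hc_weightE mulr_ge0 ?expR_ge0. Qed.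

Lemma hc_partition_gt0 b : 0 < hc_partition G b.
Proof.
rewrite /hc_partition (bigD1 [ffun=> false])//= ltr_pwDl//.
  rewrite hc_weightE mulr_gt0 ?expR_gt0// ltr0n lt0b.
  by apply/independentP => u v _; rewrite !ffunE.
by apply: sumr_ge0 => s _; exact: hc_weight_ge0.
Qed.

(** Turns the assumption that [s] can be sampled into the combinatorial fact used by all later
    computations. *)
Lemma hardcore_gt0_independent b s : 0 < hardcore G b s -> independent N G s.
Proof.
rewrite /hardcore pmulr_lgt0 ?invr_gt0 ?hc_partition_gt0// hc_weightE.
by case: (independent N G s) => //; rewrite mulr0 ltxx.
Qed.

(** The configuration with [u] emptied serves as common reference, since its weight is positive and
    cancels in ratios. *)
Lemma hc_weight_set_coord b s u x : independent N G s ->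
  hc_weight G b (set_coord N s u x) =
  expR (b * x%:R) * (x ==> nbrs_empty N G s u)%:R
  * hc_weight G b (set_coord N s u false).
Proof.
move=> si; rewrite !hc_weightE !set_coord_independent//= mulr1 mulrAC.
rewrite -expRD -mulrDr; congr (expR (_ * _) * _).
rewrite (bigD1 u)//= [in RHS](bigD1 u)//= !ffunE eqxx add0r; congr (_ + _).
by apply: eq_bigr => v /negPf vu; rewrite !ffunE vu.
Qed.

(** The right-hand side is an exponential so that the logarithm of the product over [u] becomes a
    sum; a forced spin has probability 1, hence exponent 0. *)
Lemma hc_cond_coordE b s u : independent N G s ->
  hc_cond_coord G b s u =
  expR (if nbrs_empty N G s u then b * (s u)%:R - ln (expR b + 1) else 0).
Proof.
move=> si; rewrite /hc_cond_coord /hc_cond_prob agree_on_coord agree_off_coord.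
rewrite /hc_prob big_set1 big_setU1 ?big_set1 /=; last first.
  by rewrite inE; apply/eqP => /ffunP/(_ u); rewrite !ffunE eqxx.
rewrite /hardcore -mulrDl -mulf_div divff ?invr_eq0 ?gt_eqF ?hc_partition_gt0//.
(* Viewing [s] as its own modification at [u] makes the numerator a multiple of the reference weight
   too. *)
rewrite mulr1 -[X in hc_weight G b X / _](set_coord_self N s u).
rewrite (hc_weight_set_coord b s u (s u) si).
rewrite (hc_weight_set_coord b s u true si) /= mulr1.
set w := hc_weight _ _ _.
have w0 : w != 0.
  by rewrite /w hc_weightE set_coord_independent//= mulr1 expR_eq0.
have e0 : expR b + 1 != 0 by rewrite gt_eqF// addr_gt0 ?expR_gt0.
have -> : (s u ==> nbrs_empty N G s u).
  by apply/implyP; exact: independent_nbrs_empty.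
case: ifPn => [fu|nfu] /=.
  rewrite expRD expRN lnK ?posrE ?addr_gt0 ?expR_gt0//.
  by rewrite !mulr1 -[X in _ + X]mul1r -mulrDl -mulf_div divff// mulr1.
have /negPf -> : ~~ s u by apply: contra nfu; exact: independent_nbrs_empty.
by rewrite mulr0 expR0 mulr0 mul0r add0r !mul1r divff.
Qed.

(** * Log pseudo-likelihood, its derivative and the explicit estimate *)

Lemma sum_occupied s : \sum_(u < N) (s u)%:R = (num_occupied s)%:R :> R.
Proof.
rewrite -natr_sum /num_occupied -sum1dep_card [in RHS]big_mkcond.
by congr (_%:R).
Qed.

(** By independence every occupied vertex has an empty neighbourhood; the remaining vertices with
    this property are the unblocked ones. *)
Lemma sum_nbrs_empty s : independent N G s ->
  \sum_(u < N) (nbrs_empty N G s u)%:R =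
  (num_occupied s)%:R + (num_unblocked G s)%:R :> R.
Proof.
move=> si; rewrite -!sum_occupied /num_unblocked -sum1dep_card.
rewrite natr_sum [X in _ + X]big_mkcond -big_split /=.
apply: eq_bigr => u _; rewrite -/(nbrs_empty N G s u).
case su: (s u) => /=; first by rewrite (independent_nbrs_empty _ _ _ _ si su) addr0.
by rewrite add0r; case: (nbrs_empty N G s u).
Qed.

Lemma log_pseudolikE b s : independent N G s ->
  log_pseudolik G s b = (num_occupied s)%:R * b
    - ((num_occupied s)%:R + (num_unblocked G s)%:R) * ln (expR b + 1).
Proof.
move=> si; rewrite /log_pseudolik.
under eq_bigr do rewrite hc_cond_coordE//.
rewrite -expR_sum expRK -sum_nbrs_empty// -sum_occupied !mulr_suml -sumrB.
apply: eq_bigr => u _; case: ifPn => [_|nfu]; first by rewrite mul1r mulrC.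
have /negPf -> : ~~ s u by apply: contra nfu; exact: independent_nbrs_empty.
by rewrite !mul0r subr0.
Qed.

Lemma is_derive_log_pseudolik b s : independent N G s ->
  is_derive b (1 : R) (log_pseudolik G s) ((num_occupied s)%:R
    - expR b / (expR b + 1)
      * ((num_occupied s)%:R + (num_unblocked G s)%:R)).
Proof.
move=> si.
have -> : log_pseudolik G s = fun x : R => (num_occupied s)%:R * x
    - ((num_occupied s)%:R + (num_unblocked G s)%:R) * ln (expR x + 1).
  by apply: funext => x; exact: log_pseudolikE.
have e0 : 0 < expR b + 1 by rewrite addr_gt0 ?expR_gt0.
(* The chain rule is supplied by hand; instance inference then differentiates the whole
   expression. *)
have dln : is_derive b (1 : R) (fun x : R => ln (expR x + 1))
    ((expR b + 1)^-1 * (expR b + 0)).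
  apply: (@is_derive1_comp R (@ln R) (fun x : R => expR x + 1)).
  exact: is_derive1_ln.
apply: is_derive_eq.
rewrite /GRing.scale /= mulr1 addr0; ring.
Qed.

(** An occupied neighbour contributes [lne 0], that is [-oo], which absorbs the sum. Otherwise every
    term vanishes, by [lne 1 = 0] at neighbours and [0 * -oo = 0] elsewhere. *)
Lemma local_exponentE b s u :
  local_exponent G s b u = if nbrs_empty N G s u then b%:E else -oo%E.
Proof.
rewrite /local_exponent; case: ifPn => [/nbrs_emptyP fu|/nbrs_emptyP nfu].
  rewrite big1 ?adde0// => v _; rewrite mxE.
  have [Guv|_] := boolP (G u v); last by rewrite mul0e.
  by rewrite (negPf (fu v Guv)) subr0 (lne1 R) mule0.
have [v Guv sv] : exists2 v, G u v & s v.
  apply: contrapT => H; apply: nfu => v Guv; apply/negP => sv.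
  by apply: H; exists v.
suff -> : (\sum_(v < N | v != u)
    (adjmx R G u v)%:E * lne (1 - (s v)%:R)%:E = -oo :> \bar R)%E.
  by [].
apply/esum_eqNyP; exists v; split; first by rewrite mem_index_enum.
  by apply: contraTneq Guv => ->; rewrite adj_irr.
by rewrite mxE Guv sv subrr mul1e le0_lneNy.
Qed.

Lemma hc_LE b s : independent N G s ->
  hc_L G s b = N%:R^-1 * ((num_occupied s)%:R - expR b / (expR b + 1)
    * ((num_occupied s)%:R + (num_unblocked G s)%:R)).
Proof.
move=> si; rewrite /hc_L; congr (_ * _).
rewrite -sum_nbrs_empty// -sum_occupied mulr_sumr -sumrB.
apply: eq_bigr => u _; rewrite local_exponentE; congr (_ - _).
case: ifPn => _ /=; last by rewrite mul0e mulr0.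
by rewrite inver gt_eqF ?addr_gt0 ?expR_gt0//= mulr1.
Qed.

Lemma num_occupied_unblocked_gt0 s : (0 < N)%N ->
  (0 < num_occupied s + num_unblocked G s)%N.
Proof.
move=> N0; rewrite addn_gt0; case: posnP => //= /eqP.
rewrite cards_eq0 => /eqP/setP s0; apply/card_gt0P; exists (Ordinal N0).
have sF v : s v = false by have := s0 v; rewrite !inE.
by rewrite inE sF; apply/nbrs_emptyP => v; rewrite sF.
Qed.

(** The form without division also covers the degenerate cases: if exactly one count is zero, both
    sides fail because [expR b] is positive and finite. *)
Lemma eq_beta_hat b s : (0 < N)%N ->
  b%:E = beta_hat G s <->
  (num_occupied s)%:R = (num_unblocked G s)%:R * expR b.
Proof.
move=> /num_occupied_unblocked_gt0 => /(_ s); rewrite /beta_hat.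
set c := num_occupied s; set m := num_unblocked G s => cm.
set x := (_ / _)%E.
have x0 : (0 <= x)%E by rewrite mule_ge0 ?inve_ge0 ?lee_fin.
have -> : b%:E = lne x <-> (expR b)%:E = x.
  split=> [|<-]; last by rewrite -[LHS]expeRK.
  by move=> /(congr1 expeR) /= ->; apply/eqP; rewrite lneK_eq.
(* If [m = 0] then [c > 0], so the quotient is [+oo] and cannot equal a real exponential, while the
   product equation would force [c = 0]. *)
rewrite /x inver pnatr_eq0; case: eqP => [m0|/eqP m0].
  move: cm; rewrite m0 addn0 => c0.
  rewrite mul0r gt0_muley ?lte_fin ?ltr0n//; split => // /eqP.
  by rewrite pnatr_eq0 gtn_eqF.
rewrite -EFinM; split => [[->]|->]; first by rewrite mulrC divfK ?pnatr_eq0.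
by rewrite mulrAC divff ?mul1r ?pnatr_eq0.
Qed.

End Hardcore.

Theorem proposition2p3 (R : realType) (N : nat) (G : simple_graph N)
    (beta : R) (sigma : config N)
    (N_gt0 : (0 < N)%N) (G_no_isolated : no_isolated_vertex G)
    (sigma_sample : 0 < hardcore G beta sigma) :
  [/\ (forall b : R,
         is_derive b (1 : R) (log_pseudolik G sigma) (N%:R * hc_L G sigma b)),
      (forall b : R,
         hc_L G sigma b =
           N%:R^-1 * ((num_occupied sigma)%:R
             - expR b / (expR b + 1)
               * ((num_occupied sigma)%:R + (num_unblocked G sigma)%:R)))
    & (forall b : R, mpl_estimate G sigma b <-> b%:E = beta_hat G sigma)].
Proof.
have si := hardcore_gt0_independent _ _ _ _ _ sigma_sample.
have dl b := is_derive_log_pseudolik R N G b sigma si.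
split=> b; last 2 first.
- exact: hc_LE.
- rewrite eq_beta_hat// /mpl_estimate.
  have e0 : expR b + 1 != 0 by rewrite gt_eqF// addr_gt0 ?expR_gt0.
  (* Uniqueness of the derivative turns criticality into the vanishing of the explicit formula. *)
  have -> : is_derive b (1 : R) (log_pseudolik G sigma) (0 : R) <->
      (num_occupied sigma)%:R - expR b / (expR b + 1)
        * ((num_occupied sigma)%:R + (num_unblocked G sigma)%:R) = 0.
    split=> [d0|d0]; last by rewrite -d0.
    by rewrite -(@derive_val _ _ _ _ _ _ _ (dl b)) (@derive_val _ _ _ _ _ _ _ d0).
  set c := _%:R; set m := _%:R.
  have -> : c - expR b / (expR b + 1) * (c + m) =
      (c - m * expR b) / (expR b + 1) by field.
  split=> [/eqP|->]; last by rewrite subrr mul0r.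
  by rewrite mulf_eq0 invr_eq0 (negPf e0) orbF subr_eq0 => /eqP.
- by rewrite hc_LE// mulVKf// pnatr_eq0 -lt0n.
Qed.
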